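(* Let $p$ be an odd prime. Then \[ \sum_{k=0}^{p-1}(205k^2+160k+32)(-1)^k\binom{2k}{k}^5\equiv 32p^2+64p^3H_{p-1}\pmod{p^7}\quad\text{for } p\neq5, \] and \[ \sum_{k=0}^{(p-1)/2}(205k^2+160k+32)(-1)^k\binom{2k}{k}^5\equiv 32p^2\pmod{p^5}\quad\text{for } p>3, \] where $H_{p-1}=\sum_{k=1}^{p-1}1/k$ and the congruences are understood in the ring of rationals with denominators prime to $p$. *)

(* Defs.v *)
From mathcomp Require Import all_boot all_algebra.
Set Implicit Arguments. Unset Strict Implicit. Unset Printing Implicit Defensive.
Import GRing.Theory Num.Theory.
Local Open Scope ring_scope.

Definition p_integral (p : nat) (q : rat) : bool := ~~ (p %| `|denq q|)%N.

Definition congr_p (p n : nat) (a b : rat) : Prop :=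
  [/\ p_integral p a, p_integral p b &
      exists2 r : rat, p_integral p r & a - b = (p ^ n)%:R * r].

Definition harmonic (m : nat) : rat := \sum_(1 <= k < m.+1) (k%:R)^-1.

Definition term8 (k : nat) : rat :=
  (205 * k ^ 2 + 160 * k + 32)%:R * (-1) ^+ k * ('C(k.*2, k))%:R ^+ 5.

(* Main.v *)
Require Import Defs.
From mathcomp Require Import all_boot all_algebra.
From mathcomp Require Import ring zify.
Import GRing.Theory Num.Theory.
Local Open Scope ring_scope.

(** A Wilf-Zeilberger pair (the dual, read along the diagonal [k = n + j], of
the Amdeberhan-Zeilberger pair for zeta(3)) turns the partial sums of [term8]
into closed-form sums: [sum_(k <= n) term8 k = sum_(m <= n) wz_term n m].

For [n = p - 1] one has [wz_term n 0 = 32 p^2 C^5] with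
[C = binom(2p-1, p-1) = prod_(i < p) (1 - p^2/i^2) = 1 - p^2 H2 mod p^5], since
[prod_(i < p) (1 - p/i) = 1]; the other terms are [4 p^2 t_m] times this one,
and [t_m] expands so that [sum_m t_m = H2 mod p^3], where [Hr] is the sum of
[i^-r] over [0 < i < p].  The total is [32 p^2 (1 - p^2 H2) mod p^7], and
[2 H1 = - p H2 mod p^4] concludes.

For [n = (p - 1)/2] all terms but the last vanish mod [p^5], and the last one
is [32 p^2 prod_(i <= n) (1 - p^2/i^2)^2].  *)

(** * The Wilf-Zeilberger pair *)

(** Meant for [m <= n], since [n - m] is truncated; every use stays in that range. *)
Definition wz_term (n m : nat) : rat :=
  32 * (-1) ^+ (n + m)
  * ((n.*2.+1)`!%:R ^+ 3 * ((n.*2 + m).+1)`!%:R ^+ 2)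
  / (n`!%:R ^+ 6 * (n - m)`!%:R * ((n + m).+1)`!%:R ^+ 3).

(* Interpolated from numerical values of [wz_cert], which is determined by
   [wz_cert n 0 = - term8 n.+1] and the telescoping relation [wz_step]. *)
Definition wz_poly (x y : rat) : rat :=
  1024 * x ^+ 2 + 5120 * x ^+ 3 + 6560 * x ^+ 4
  + y * (1024 * x + 6144 * x ^+ 2 + 9184 * x ^+ 3)
  + y ^+ 2 * (256 + 2304 * x + 4320 * x ^+ 2) + y ^+ 3 * (256 + 672 * x).

(** For [m <= n] this is [wz_term n m] times [wz_poly N M / (32 (N - M) N^3)]. Absorbing [N - M]
    into the factorial [(n.+1 - m)!] gives it a value also at [m = n.+1], the upper end of the
    telescoping. *)
Definition wz_cert (n m : nat) : rat :=
  let N : rat := n.+1%:R in let M : rat := m%:R in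
  (-1) ^+ (n + m)
  * ((n.*2.+1)`!%:R ^+ 3 * ((n.*2 + m).+1)`!%:R ^+ 2)
  / (n`!%:R ^+ 6 * (n.+1 - m)`!%:R * ((n + m).+1)`!%:R ^+ 3 * N ^+ 3)
  * wz_poly N M.

Lemma fact_neq0 (n : nat) : n`!%:R != 0 :> rat.
Proof. by rewrite pnatr_eq0 -lt0n fact_gt0. Qed.

Lemma natr_fact_succ (n : nat) : (n.+1)`!%:R = n.+1%:R * n`!%:R :> rat.
Proof. by rewrite factS natrM. Qed.

(** The relation of [wz_step] divided by [wz_term n m / 32], with [x = n + 1] and [y = m]. *)
Lemma wz_rational (x y : rat) :
  x != 0 -> x - y != 0 -> x + y + 1 != 0 ->
  - 32 * ((2 * x + 1) * (2 * x)) ^+ 3 * ((2 * x + y + 1) * (2 * x + y)) ^+ 2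
     / (x ^+ 6 * (x - y) * (x + y + 1) ^+ 3) - 32
  = - (2 * x + y) ^+ 2 / ((x + y + 1) ^+ 3 * x ^+ 3) * wz_poly x (y + 1)
    - wz_poly x y / ((x - y) * x ^+ 3).
Proof.
move=> x0 xy0 xy1; rewrite /wz_poly; field.
by rewrite x0 xy0 xy1.
Qed.

Lemma wz_step (n m : nat) (le_mn : (m <= n)%N) :
  wz_term n.+1 m - wz_term n m = wz_cert n m.+1 - wz_cert n m.
Proof.
(* With [n = m + d] the truncated differences become [d] and [d.+1]. *)
rewrite -(subnKC le_mn); move: (n - m)%N => d {n le_mn}.
rewrite /wz_term /wz_cert /=.
have -> : ((m + d).+1 - m = d.+1)%N by lia.
have -> : ((m + d).+1 - m.+1 = d)%N by lia.
have -> : (m + d - m = d)%N by lia.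
have -> : (((m + d).+1).*2.+1 = ((m + d).*2.+1).+2)%N by lia.
have -> : ((((m + d).+1).*2 + m).+1 = (((m + d).*2 + m).+1).+2)%N by lia.
have -> : ((((m + d).*2 + m.+1)).+1 = (((m + d).*2 + m).+1).+1)%N by lia.
have -> : (((m + d).+1 + m).+1 = ((m + d + m).+1).+1)%N by lia.
have -> : ((m + d + m.+1).+1 = ((m + d + m).+1).+1)%N by lia.
have -> : ((m + d).+1 + m = (m + d + m).+1)%N by lia.
have -> : (m + d + m.+1 = (m + d + m).+1)%N by lia.
rewrite !natr_fact_succ !(exprS (-1)).
have := fact_neq0 (m + d); have := fact_neq0 d; have := fact_neq0 (m + d + m).
move: ((m + d + m)`!%:R : rat) ((m + d)`!%:R : rat) (d`!%:R : rat) => e c f.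
move: (((m + d).*2)`!%:R : rat) (((m + d).*2 + m)`!%:R : rat) => a b.
move: ((-1) ^+ _ : rat) => s e0 f0 c0.
have xE : (m + d).+1%:R = m%:R + d%:R + 1 :> rat by rewrite -natr1 natrD.
set x : rat := (m + d).+1%:R in xE *; set y : rat := m%:R in xE *.
have -> : (m + d).*2.+3%:R = 2 * x + 1 by rewrite -natrM natr1; congr _%:R; lia.
have -> : (m + d).*2.+2%:R = 2 * x by rewrite -natrM; congr _%:R; lia.
have -> : ((m + d).*2 + m).+3%:R = 2 * x + y + 1
  by rewrite -natrM -natrD natr1; congr _%:R; lia.
have -> : ((m + d).*2 + m).+2%:R = 2 * x + y
  by rewrite -natrM -natrD; congr _%:R; lia.
have e2 : (m + d + m).+2%:R = x + y + 1
  by rewrite -natrD natr1; congr _%:R; lia.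
have e3 : d.+1%:R = x - y by rewrite xE -natr1; ring.
have e4 : m.+1%:R = y + 1 by rewrite natr1.
have x0 : x != 0 by rewrite pnatr_eq0.
have xy0 : x - y != 0 by rewrite -e3 pnatr_eq0.
have xy1 : x + y + 1 != 0 by rewrite -e2 pnatr_eq0.
have g0 : (m + d + m).+1%:R != 0 :> rat by rewrite pnatr_eq0.
rewrite e2 e3 e4; clearbody x y; move: g0 (wz_rational x y x0 xy0 xy1).
move: ((m + d).*2.+1%:R * a : rat) (((m + d).*2 + m).+1%:R * b : rat).
move=> {}a {}b; move: ((m + d + m).+1%:R : rat) => g g0.
move: (wz_poly x (y + 1)) (wz_poly x y) => P Q E.
(* [B] is [wz_term n m / 32], the factor common to all four terms. *)
pose B := s * (a ^+ 3 * b ^+ 2) / (c ^+ 6 * f * (g * e) ^+ 3).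
transitivity (B * (- 32 * ((2 * x + 1) * (2 * x)) ^+ 3
    * ((2 * x + y + 1) * (2 * x + y)) ^+ 2
    / (x ^+ 6 * (x - y) * (x + y + 1) ^+ 3) - 32)).
  by rewrite /B; field; rewrite xy1 xy0 x0 e0 g0 f0 c0.
by rewrite E /B; field; rewrite xy1 xy0 x0 e0 g0 f0 c0.
Qed.

(** At [y = 0] the certificate polynomial is [32 x^2 (205 x^2 + 160 x + 32)], which yields the
    coefficients of [term8]. *)
Lemma wz_cert0 (n : nat) : wz_cert n 0 = - term8 n.+1.
Proof.
rewrite /wz_cert /term8 !addn0 subn0.
have -> : 'C(n.+1.*2, n.+1)%:R
    = (n.*2.+2)`!%:R / ((n.+1)`!%:R * (n.+1)`!%:R) :> rat.
  have le_n : (n.+1 <= n.+1.*2)%N by lia.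
  rewrite -[n.*2.+2]/(n.+1.*2) -(bin_fact le_n) natrM natrM.
  have -> : (n.+1.*2 - n.+1 = n.+1)%N by lia.
  by rewrite mulfK // mulf_neq0 ?fact_neq0.
have -> : (205 * n.+1 ^ 2 + 160 * n.+1 + 32)%:R
    = 205 * n.+1%:R ^+ 2 + 160 * n.+1%:R + 32 :> rat.
  by rewrite !natrD !natrM; ring.
rewrite (exprS (-1)) !natr_fact_succ.
have -> : n.*2.+2%:R = 2 * n.+1%:R :> rat by rewrite -natrM; congr _%:R; lia.
have := fact_neq0 n; have : n.+1%:R != 0 :> rat by rewrite pnatr_eq0.
move: (n.+1%:R) (n`!%:R) => x c x0 c0.
by rewrite /wz_poly; field; rewrite x0 c0.
Qed.

(** The sum over [m] gains one term when [n] becomes [n.+1]; the upper boundary value of the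
    certificate accounts for it. *)
Lemma wz_cert_diag (n : nat) : wz_cert n n.+1 = - wz_term n.+1 n.+1.
Proof.
rewrite /wz_cert /wz_term subnn addnS addSn.
have -> : ((n.*2 + n.+1).+1 = (n.*2 + n).+2)%N by lia.
have -> : ((n.+1.*2 + n.+1).+1 = (n.*2 + n).+4)%N by lia.
rewrite addnS doubleS !natr_fact_succ !(exprS (-1)).
have -> : n.*2.+3%:R = 2 * n.+1%:R + 1 :> rat
  by rewrite -natrM natr1; congr _%:R; lia.
have -> : n.*2.+2%:R = 2 * n.+1%:R :> rat by rewrite -natrM; congr _%:R; lia.
have -> : (n.*2 + n).+3%:R = 3 * n.+1%:R :> rat by rewrite -natrM; congr _%:R; lia.
have -> : (n.*2 + n).+4%:R = 3 * n.+1%:R + 1 :> rat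
  by rewrite -natrM natr1; congr _%:R; lia.
have -> : (n + n).+3%:R = 2 * n.+1%:R + 1 :> rat
  by rewrite -natrM natr1; congr _%:R; lia.
have : (n + n).+2%:R * ((n + n).+1%:R * (n + n)`!%:R) != 0 :> rat.
  by rewrite -natr_fact_succ -natr_fact_succ fact_neq0.
have : 2 * n.+1%:R + 1 != 0 :> rat by rewrite -natrM natr1 pnatr_eq0.
have := fact_neq0 n; have : n.+1%:R != 0 :> rat by rewrite pnatr_eq0.
rewrite fact0.
move: (n.*2.+1%:R * _ : rat) ((n.*2 + n).+2%:R * _ : rat) => a b.
move: ((n + n).+2%:R * _ : rat) (n.+1%:R : rat) (n`!%:R : rat) => g x c.
move=> x0 c0 x1 g0; rewrite /wz_poly; field.
by rewrite x0 c0 x1 g0.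
Qed.

(** Induction on [n]: the differences [A n.+1 m - A n m] over [m <= n] telescope to
    [G n n.+1 - G n 0 = t n.+1 - A n.+1 n.+1]. *)
Lemma wz_telescope (V : zmodType) (t : nat -> V) (A G : nat -> nat -> V) :
  t 0 = A 0 0 ->
  (forall n m, (m <= n)%N -> A n.+1 m - A n m = G n m.+1 - G n m) ->
  (forall n, G n 0 = - t n.+1) -> (forall n, G n n.+1 = - A n.+1 n.+1) ->
  forall n, \sum_(0 <= k < n.+1) t k = \sum_(0 <= m < n.+1) A n m.
Proof.
move=> t0 stepA G0 Gdiag; elim=> [|n IHn]; first by rewrite !big_nat1.
rewrite big_nat_recr //= IHn [RHS]big_nat_recr //=.
have := telescope_sumr (G n) (leq0n n.+1); rewrite G0 Gdiag.
have -> : \sum_(0 <= m < n.+1) (G n m.+1 - G n m)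
    = \sum_(0 <= m < n.+1) (A n.+1 m - A n m).
  by apply: eq_big_nat => m /andP[_ lt_mn]; rewrite stepA.
rewrite sumrB opprK => /eqP; rewrite subr_eq => /eqP ->.
by rewrite [RHS]addrC !addrA subrr add0r addrC.
Qed.

Lemma sum_term8E (n : nat) :
  \sum_(0 <= k < n.+1) term8 k = \sum_(0 <= m < n.+1) wz_term n m.
Proof.
apply: (wz_telescope _ term8 wz_term wz_cert).
- by apply/eqP; vm_compute.
- exact: wz_step.
- exact: wz_cert0.
- exact: wz_cert_diag.
Qed.

(** * Orders of divisibility in the local ring at p *)

(** The reduced denominator of [q] divides [d], by Gauss's lemma applied to
    [numq q * d = a * denq q]. *)
Lemma p_integral_frac (p d : nat) (a : int) :
  prime p -> ~~ (p %| d)%N -> p_integral p (a%:~R / d%:R).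
Proof.
move=> pr_p; apply: contra => p_den; have d0 : d%:R != 0 :> rat.
  (* If [d] were 0, the quotient would be 0 because [0^-1 = 0], and its denominator 1 is prime to
     [p]. *)
  apply: contraTneq p_den => ->.
  by rewrite invr0 mulr0 dvdn1 neq_ltn prime_gt1 ?orbT.
set q := _ / _ in p_den.
have E : numq q * d%:Z = a * denq q.
  apply: (@intr_inj rat); rewrite !intrM numqE -[d%:Z%:~R]/(d%:R) /q.
  by field.
have := coprime_num_den q => cop.
have dvd : (`|denq q| %| `|numq q| * d)%N.
  by rewrite -[d]/(`|d%:Z|%N) -abszM E abszM dvdn_mull.
rewrite Gauss_dvdr 1?coprime_sym // in dvd.
exact: dvdn_trans p_den dvd.
Qed.

Lemma p_integralE (p : nat) (q : rat) : p_integral p q ->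
  exists a d, ~~ (p %| d)%N /\ q = a%:~R / d%:R.
Proof.
move=> hq; exists (numq q), `|denq q|%N; split=> //.
by rewrite -[_%:R]/(`|denq q|%N%:Z%:~R) absz_denq divq_num_den.
Qed.

Lemma p_integral_int (p : nat) (a : int) : prime p -> p_integral p a%:~R.
Proof.
move=> pr_p; rewrite -[a%:~R]divr1; apply: (p_integral_frac p 1) => //.
by rewrite dvdn1 neq_ltn prime_gt1 ?orbT.
Qed.

Lemma p_integralD (p : nat) (x y : rat) : prime p ->
  p_integral p x -> p_integral p y -> p_integral p (x + y).
Proof.
move=> pr_p /p_integralE[a [d [pd ->]]] /p_integralE[b [e [pe ->]]].
have nz k : ~~ (p %| k)%N -> k%:R != 0 :> rat.
  by rewrite pnatr_eq0; apply: contra => /eqP ->; rewrite dvdn0.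
rewrite addf_div ?nz // -natrM -[d%:R]/(d%:Z%:~R) -[e%:R]/(e%:Z%:~R) -!intrM -intrD.
by rewrite p_integral_frac // Euclid_dvdM // negb_or pd.
Qed.

Lemma p_integralM (p : nat) (x y : rat) : prime p ->
  p_integral p x -> p_integral p y -> p_integral p (x * y).
Proof.
move=> pr_p /p_integralE[a [d [pd ->]]] /p_integralE[b [e [pe ->]]].
rewrite mulf_div -natrM -intrM p_integral_frac //.
by rewrite Euclid_dvdM // negb_or pd.
Qed.

Lemma p_integral_natV (p k : nat) : prime p -> ~~ (p %| k)%N -> p_integral p k%:R^-1.
Proof. by move=> pr_p pk; rewrite -[_^-1]mul1r; apply: (p_integral_frac p k 1). Qed.

Lemma p_integral_nat (p k : nat) : prime p -> p_integral p k%:R.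
Proof. exact: (p_integral_int p k). Qed.

(* [pO p n x]: [x] is an O(p^n), that is, [x] lies in [p^n Z_(p)]. *)
Definition pO (p n : nat) (x : rat) : Prop :=
  exists2 r : rat, p_integral p r & x = (p ^ n)%:R * r.

Lemma pO0 (p : nat) (x : rat) : p_integral p x -> pO p 0 x.
Proof. by exists x; rewrite // expn0 mul1r. Qed.

Lemma pO_integral (p n : nat) (x : rat) : prime p -> pO p n x -> p_integral p x.
Proof. by move=> pr_p [r hr ->]; rewrite p_integralM ?p_integral_nat. Qed.

Lemma pOW (p m n : nat) (x : rat) : prime p -> (m <= n)%N -> pO p n x -> pO p m x.
Proof.
move=> pr_p le_mn [r hr ->]; exists ((p ^ (n - m))%:R * r).
  by rewrite p_integralM ?p_integral_nat.
by rewrite mulrA -natrM -expnD subnKC.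
Qed.

Lemma pOD (p n : nat) (x y : rat) : prime p ->
  pO p n x -> pO p n y -> pO p n (x + y).
Proof.
move=> pr_p [r hr ->] [s hs ->]; exists (r + s); last by rewrite mulrDr.
exact: p_integralD.
Qed.

Lemma pOM (p m n : nat) (x y : rat) : prime p ->
  pO p m x -> pO p n y -> pO p (m + n) (x * y).
Proof.
move=> pr_p [r hr ->] [s hs ->]; exists (r * s); first exact: p_integralM.
by rewrite expnD natrM mulrACA.
Qed.

Lemma pOMr (p n : nat) (x y : rat) : prime p ->
  pO p n x -> p_integral p y -> pO p n (x * y).
Proof. by move=> pr_p hx /pO0 hy; rewrite -[n]addn0; apply: pOM. Qed.

Lemma pON (p n : nat) (x : rat) : prime p -> pO p n x -> pO p n (- x).
Proof.
move=> pr_p hx; rewrite -mulrN1; apply: pOMr => //.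
exact: (p_integral_int p (-1)).
Qed.

Lemma pO_zero (p n : nat) : prime p -> pO p n 0.
Proof. by move=> pr_p; exists 0; rewrite ?mulr0 // (p_integral_nat p 0). Qed.

Lemma pO_sum (p n a b : nat) (F : nat -> rat) : prime p ->
  (forall i, (a <= i < b)%N -> pO p n (F i)) -> pO p n (\sum_(a <= i < b) F i).
Proof.
move=> pr_p hF; rewrite big_nat_cond.
apply: (big_ind (pO p n)); first exact: pO_zero.
  by move=> x y; apply: pOD.
by move=> i /andP[hi _]; apply: hF.
Qed.

Lemma pO_exp (p n k : nat) (x : rat) : prime p ->
  pO p n x -> pO p (n * k) (x ^+ k).
Proof.
move=> pr_p hx; elim: k => [|k IHk].
  by rewrite muln0 expr0; apply/pO0/(p_integral_nat p 1).
by rewrite mulnS exprS; apply: pOM.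
Qed.

Lemma p_integralN (p : nat) (x : rat) : prime p ->
  p_integral p x -> p_integral p (- x).
Proof. by move=> pr_p /pO0/(pON _ _ _ pr_p)/(pO_integral _ _ _ pr_p). Qed.

Lemma p_integralX (p k : nat) (x : rat) : prime p ->
  p_integral p x -> p_integral p (x ^+ k).
Proof. by move=> pr_p /pO0/(pO_exp _ _ k _ pr_p)/(pO_integral _ _ _ pr_p). Qed.

Lemma p_integral1 (p : nat) : prime p -> p_integral p 1.
Proof. exact: (p_integral_nat p 1). Qed.

Lemma pOMl (p n : nat) (x y : rat) : prime p ->
  p_integral p x -> pO p n y -> pO p n (x * y).
Proof. by move=> pr_p hx hy; rewrite mulrC; apply: pOMr. Qed.

Lemma pO_pow (p n : nat) : prime p -> pO p n (p%:R ^+ n).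
Proof.
by move=> pr_p; exists 1; [apply: p_integral1 | rewrite mulr1 natrX].
Qed.

Lemma pOpM (p n : nat) (x : rat) : prime p -> pO p n x -> pO p n.+1 (p%:R * x).
Proof. by move=> pr_p; apply: (pOM p 1) => //; apply: (pO_pow p 1). Qed.

(** Recursion on the shape of the expression. Inverses have no rule: their integrality has to be in
    the context, which is the purpose of facts such as [hV2], [hy] and [hV] below. *)
Ltac pint :=
  lazymatch goal with
  | |- is_true (p_integral _ ?x) =>
    first
    [ assumption
    | lazymatch x with
      | (_ + _)%R => apply: p_integralD; [assumption | pint | pint]
      | (_ * _)%R => apply: p_integralM; [assumption | pint | pint]
      | (- _)%R => apply: p_integralN; [assumption | pint]
      | (_ ^+ _)%R => apply: p_integralX; [assumption | pint]
      | 1%R => apply: p_integral1; assumption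
      | (_%:R)%R => apply: p_integral_nat; assumption
      | _ => idtac
      end ]
  end.

(** * Power sums of inverses modulo powers of p *)

Definition inv_psum (r n : nat) : rat := \sum_(1 <= i < n.+1) i%:R^-1 ^+ r.

Lemma harmonicE (n : nat) : harmonic n = inv_psum 1 n.
Proof. by apply: eq_bigr => i _; rewrite expr1. Qed.

Lemma sum_nat_reflect (V : nmodType) (F : nat -> V) (n : nat) :
  \sum_(1 <= i < n) F i = \sum_(1 <= i < n) F (n - i)%N.
Proof. by rewrite big_nat_rev; apply: eq_big_nat => i _; congr F; lia. Qed.

(** With [p = h.*2.+1], the odd indices below [p] are the [p - 2k], hence opposite to the even ones
    mod [p]. *)
Lemma sum_nat_parity (V : nmodType) (F : nat -> V) (h : nat) :
  \sum_(1 <= i < h.*2.+1) F i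
  = \sum_(1 <= k < h.+1) (F k.*2 + F (h.*2.+1 - k.*2)%N).
Proof.
have -> : \sum_(1 <= i < h.*2.+1) F i
    = \sum_(1 <= k < h.+1) F k.*2 + \sum_(1 <= k < h.+1) F k.*2.-1.
  elim: h => [|h IHh]; first by rewrite !big_geq // addr0.
  rewrite !(big_nat_recr h.+1) //= doubleS 2?big_nat_recr //= IHh.
  by rewrite -addrA [RHS]addrACA [in RHS](addrC (F _.*2.+2)).
rewrite big_split /=; congr (_ + _); rewrite (sum_nat_reflect _ _ h.+1).
by apply: eq_big_nat => k hk; congr F; lia.
Qed.

Lemma sum_nat_halves (V : nmodType) (F : nat -> V) (h : nat) :
  \sum_(1 <= i < h.*2.+1) F i
  = \sum_(1 <= k < h.+1) (F k + F (h.*2.+1 - k)%N).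
Proof.
rewrite (@big_cat_nat _ _ _ h.+1) //=; last by lia.
rewrite big_split /=; congr (_ + _).
rewrite -[h.+1 in LHS]add1n big_addn (_ : h.*2.+1 - h = h.+1)%N; last by lia.
rewrite (sum_nat_reflect _ _ h.+1).
by apply: eq_big_nat => k hk; congr F; lia.
Qed.

Lemma not_dvd_lt (p i : nat) : (1 <= i < p)%N -> ~~ (p %| i)%N.
Proof. by case/andP=> i0 ip; rewrite gtnNdvd. Qed.

Lemma inv_reflect (p i : nat) : prime p -> (1 <= i < p)%N ->
  pO p 1 ((p - i)%:R^-1 + i%:R^-1).
Proof.
move=> pr_p hi; have /andP[i0 ip] := hi.
have hj : (1 <= p - i < p)%N by lia.
exists ((p - i)%:R^-1 * i%:R^-1).
  by apply: p_integralM => //; apply: p_integral_natV => //; apply: not_dvd_lt.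
have : i%:R != 0 :> rat by rewrite pnatr_eq0 -lt0n.
have : (p - i)%:R != 0 :> rat by rewrite pnatr_eq0; lia.
have eP : p%:R = (p - i)%:R + i%:R :> rat by rewrite -natrD subnK // ltnW.
rewrite expn1 eP; move: ((p - i)%:R : rat) (i%:R : rat) => x y x0 y0.
by field; rewrite x0 y0.
Qed.

(** The inverses of [i] and [p - i] are opposite mod [p], so their squares agree, and then all
    powers of the squares. *)
Lemma inv_reflect_even (p i s : nat) : prime p -> (1 <= i < p)%N ->
  pO p 1 ((p - i)%:R^-1 ^+ s.*2 - i%:R^-1 ^+ s.*2).
Proof.
move=> pr_p hi; have hxy := inv_reflect p i pr_p hi; have hj : (1 <= p - i < p)%N by lia.
have hx : p_integral p (i%:R^-1) by apply: p_integral_natV => //; apply: not_dvd_lt.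
have hy : p_integral p ((p - i)%:R^-1) by apply: p_integral_natV => //; apply: not_dvd_lt.
rewrite -!muln2 !(mulnC s) !exprM.
have hX : p_integral p ((p - i)%:R^-1 ^+ 2) by rewrite expr2 p_integralM.
have hY : p_integral p (i%:R^-1 ^+ 2) by rewrite expr2 p_integralM.
have : pO p 1 ((p - i)%:R^-1 ^+ 2 - i%:R^-1 ^+ 2).
  rewrite subr_sqr mulrC; apply: pOMr => //.
  by apply: p_integralD => //; apply: pO_integral pr_p (pON p 0 _ pr_p (pO0 _ _ hx)).
move: (_ ^+ 2 : rat) (i%:R^-1 ^+ 2 : rat) hX hY => X Y hX hY hXY.
elim: s => [|s IHs]; first by rewrite !expr0 subrr; apply: pO_zero.
rewrite !exprS (_ : _ - _ = (X ^+ s - Y ^+ s) * X + (X - Y) * Y ^+ s); last by ring.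
apply: pOD => //; apply: pOMr => //.
by apply: pO_integral pr_p (pO_exp _ _ s _ pr_p (pO0 _ _ hY)).
Qed.

Lemma inv_psum_half (p h s : nat) : prime p -> p = h.*2.+1 ->
  pO p 1 (inv_psum s.*2 p.-1 - 2 * inv_psum s.*2 h).
Proof.
move=> pr_p p_eq; rewrite p_eq /= /inv_psum sum_nat_halves mulr_sumr -sumrB -p_eq.
apply: pO_sum => // i hi; set x := _ ^+ _; set y := _ ^+ _.
rewrite (_ : _ - _ = y - x); last by ring.
by apply: inv_reflect_even => //; lia.
Qed.

Lemma inv_psum_double (p h s : nat) : prime p -> p = h.*2.+1 ->
  pO p 1 (inv_psum s.*2 p.-1 - 2 * 2^-1 ^+ s.*2 * inv_psum s.*2 h).
Proof.
move=> pr_p p_eq; rewrite p_eq /= /inv_psum sum_nat_parity mulr_sumr -sumrB -p_eq.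
apply: pO_sum => // i hi.
have -> : 2 * 2^-1 ^+ s.*2 * i%:R^-1 ^+ s.*2 = 2 * i.*2%:R^-1 ^+ s.*2 :> rat.
  by rewrite -(mul2n i) natrM invfM exprMn mulrA.
set x := _ ^+ _; set y := _ ^+ _.
rewrite (_ : _ - _ = y - x); last by ring.
by apply: inv_reflect_even => //; lia.
Qed.

(** Let [T = inv_psum s.*2 h]. Pairing [k] with [p - k], respectively [2k] with [p - 2k], evaluates
    the sum over all [i < p] mod [p] as [2 T] and as [2 T / 4^s]. Hence [(4^s - 1) T = 0] mod
    [p]. *)
Lemma inv_psum_half0 (p h s : nat) : prime p -> p = h.*2.+1 ->
  ~~ (p %| (4 ^ s).-1)%N -> pO p 1 (inv_psum s.*2 h).
Proof.
move=> pr_p p_eq p4.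
have p2 : ~~ (p %| 2)%N by rewrite gtnNdvd // p_eq; move: (prime_gt1 pr_p); lia.
have := pOD _ _ _ _ pr_p (inv_psum_double p h s pr_p p_eq)
  (pON _ _ _ pr_p (inv_psum_half p h s pr_p p_eq)).
move: (inv_psum _ p.-1) (inv_psum _ h) => S T hT.
(* The last factor is the inverse of [2 - 2 / 4^s]. *)
have -> : T = (2 - 2 * 2^-1 ^+ s.*2) * T * (2^-1 * (4 ^ s)%:R * (4 ^ s).-1%:R^-1).
  have e4 : (4 ^ s)%:R = (4 ^ s).-1%:R + 1 :> rat by rewrite natr1 prednK ?expn_gt0.
  have -> : 2^-1 ^+ s.*2 = ((4 ^ s)%:R)^-1 :> rat by rewrite -mul2n exprM natrX -exprVn.
  have : (4 ^ s)%:R != 0 :> rat by rewrite pnatr_eq0 expn_eq0.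
  have : (4 ^ s).-1%:R != 0 :> rat.
    by rewrite pnatr_eq0; apply: contra p4 => /eqP ->; rewrite dvdn0.
  by rewrite e4; move: ((4 ^ s).-1%:R : rat) => z z0 z1; field; rewrite z1 z0.
apply: pOMr => //; first by move: hT; congr (pO p 1); ring.
apply: p_integralM => //; last exact: p_integral_natV.
by apply: p_integralM; rewrite ?p_integral_nat ?p_integral_natV.
Qed.

Lemma inv_psum_even0 (p s : nat) : prime p -> odd p ->
  ~~ (p %| (4 ^ s).-1)%N -> pO p 1 (inv_psum s.*2 p.-1).
Proof.
move=> pr_p odd_p p4; have p_eq : p = (p.-1./2).*2.+1 by lia.
have hh := inv_psum_half0 _ _ _ pr_p p_eq p4.
rewrite -[X in pO _ _ X](subrK (2 * inv_psum s.*2 p.-1./2)).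
apply: pOD => //; first exact: inv_psum_half.
by rewrite mulrC; apply: pOMr => //; apply: (p_integral_nat p 2).
Qed.

(** The restriction [5 < p] enters here: 3 and 5 are the primes dividing [4^2 - 1]. *)
Lemma inv_psum4 (p : nat) : prime p -> odd p -> (5 < p)%N ->
  pO p 1 (inv_psum 4 p.-1).
Proof.
move=> pr_p odd_p p5; apply: (inv_psum_even0 p 2) => //.
by rewrite (_ : _.-1 = 3 * 5)%N // Euclid_dvdM // !gtnNdvd //; lia.
Qed.

(** Reflecting [i] to [p - i] and using [(p - i)^-3 = - i^-3 - 3 p i^-4] mod [p^2] gives
    [2 H3 = - 3 p H4] mod [p^2], and [p] divides [H4]. *)
Lemma inv_psum3 (p : nat) : prime p -> odd p -> (5 < p)%N ->
  pO p 2 (inv_psum 3 p.-1).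
Proof.
move=> pr_p odd_p p5.
have p_eq : p.-1.+1 = p by rewrite prednK ?prime_gt0.
have h : pO p 2 (inv_psum 3 p.-1 + inv_psum 3 p.-1 + 3 * (p%:R * inv_psum 4 p.-1)).
  rewrite {2}/inv_psum sum_nat_reflect /inv_psum p_eq !mulr_sumr -!big_split /=.
  apply: pO_sum => // i hi.
  have hj : (1 <= p - i < p)%N by lia.
  have hyV := p_integral_natV p _ pr_p (not_dvd_lt _ _ hi).
  have hxV := p_integral_natV p _ pr_p (not_dvd_lt _ _ hj).
  (* With [x = p - i] and [y = i], the numerator [3 x^4 + 4 x^3 y + y^4] factors as
     [(x + y)^2 (3 x^2 - 2 x y + y^2)]. *)
  exists (i%:R^-1 ^+ 4 * (p - i)%:R^-1 ^+ 3
          * ((p - i)%:R ^+ 2 * 3 - 2 * i%:R * (p - i)%:R + i%:R ^+ 2)); first pint.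
  have : i%:R != 0 :> rat by rewrite pnatr_eq0 -lt0n; lia.
  have : (p - i)%:R != 0 :> rat by rewrite pnatr_eq0; lia.
  have eP : p%:R = (p - i)%:R + i%:R :> rat by rewrite -natrD subnK //; lia.
  rewrite natrX eP; move: ((p - i)%:R : rat) (i%:R : rat) => x y x0 y0.
  by field; rewrite x0 y0.
have h4 := pOpM _ _ _ pr_p (inv_psum4 p pr_p odd_p p5).
have hV2 : p_integral p 2^-1 by apply: (p_integral_natV p 2); rewrite // gtnNdvd //; lia.
move: (p%:R * _) (inv_psum _ _) h h4 => Q S h h4.
rewrite (_ : S = (S + S + 3 * Q) * 2^-1 - Q * (3 * 2^-1)); last by field.
apply: pOD; [by [] | apply: pOMr => // |].
by apply: pON => //; apply: pOMr => //; pint.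
Qed.

(** The geometric expansion of [(p - i)^-1] to four terms has remainder [p^4 / (i^4 (p - i))], so
    [2 H1 + p H2 + p^2 H3 + p^3 H4] is O(p^4); its last two terms are O(p^4) themselves. *)
Lemma harmonic_inv_psum2 (p : nat) : prime p -> odd p -> (5 < p)%N ->
  pO p 4 (2 * harmonic p.-1 + p%:R * inv_psum 2 p.-1).
Proof.
move=> pr_p odd_p p5; rewrite harmonicE.
have p_eq : p.-1.+1 = p by rewrite prednK ?prime_gt0.
have h : pO p 4 (inv_psum 1 p.-1 + inv_psum 1 p.-1 + p%:R * inv_psum 2 p.-1
    + p%:R * (p%:R * inv_psum 3 p.-1) + p%:R * (p%:R * (p%:R * inv_psum 4 p.-1))).
  rewrite {2}/inv_psum sum_nat_reflect /inv_psum p_eq !mulr_sumr -!big_split /=.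
  apply: pO_sum => // i hi.
  have hj : (1 <= p - i < p)%N by lia.
  have hyV := p_integral_natV p _ pr_p (not_dvd_lt _ _ hi).
  have hxV := p_integral_natV p _ pr_p (not_dvd_lt _ _ hj).
  exists (i%:R^-1 ^+ 4 * (p - i)%:R^-1); first pint.
  have : i%:R != 0 :> rat by rewrite pnatr_eq0 -lt0n; lia.
  have : (p - i)%:R != 0 :> rat by rewrite pnatr_eq0; lia.
  have eP : p%:R = (p - i)%:R + i%:R :> rat by rewrite -natrD subnK //; lia.
  rewrite natrX eP; move: ((p - i)%:R : rat) (i%:R : rat) => x y x0 y0.
  by field; rewrite x0 y0.
have h3 := pOpM _ _ _ pr_p (pOpM _ _ _ pr_p (inv_psum3 p pr_p odd_p p5)).
have h4 := pOpM _ _ _ pr_p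
  (pOpM _ _ _ pr_p (pOpM _ _ _ pr_p (inv_psum4 p pr_p odd_p p5))).
move: h h3 h4; move: (p%:R * (p%:R * _)) (p%:R * (p%:R * (p%:R * _))).
move: (p%:R * inv_psum 2 _) (inv_psum 1 _).
move=> Q2 S Q3 Q4 h h3 h4.
rewrite (_ : 2 * S + Q2 = S + S + Q2 + Q3 + Q4 - Q3 - Q4); last by ring.
by apply: pOD => //; [apply: pOD => // |]; apply: pON.
Qed.

(** * p-adic expansion of the terms *)

Lemma inv_psum_succ (r k : nat) :
  inv_psum r k.+1 = inv_psum r k + k.+1%:R^-1 ^+ r.
Proof. by rewrite /inv_psum big_nat_recr. Qed.

Lemma inv_psum_zero (r : nat) : inv_psum r 0 = 0.
Proof. by rewrite /inv_psum big_geq. Qed.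

(** Newton's formula for the second elementary symmetric function of the [i^-r]. *)
Lemma sum_inv_psum (r k : nat) :
  \sum_(1 <= m < k.+1) inv_psum r m.-1 * m%:R^-1 ^+ r
  = (inv_psum r k ^+ 2 - inv_psum r.*2 k) / 2.
Proof.
elim: k => [|k IHk].
  by rewrite big_geq // !inv_psum_zero; ring.
rewrite big_nat_recr //= IHk !inv_psum_succ -muln2 exprM.
by move: (inv_psum r k) (inv_psum _ k) (_ ^+ r) => s q y; field.
Qed.

Lemma fact_add (n k : nat) :
  ((n + k)`!)%:R
  = n`!%:R * k`!%:R * \prod_(1 <= i < k.+1) (1 + n%:R / i%:R) :> rat.
Proof.
elim: k => [|k IHk]; first by rewrite addn0 big_geq // !mulr1.
rewrite addnS [in RHS]big_nat_recr //= natr_fact_succ IHk natr_fact_succ.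
have -> : (n + k).+1%:R = n%:R + k.+1%:R :> rat by rewrite -natrD addnS.
have : k.+1%:R != 0 :> rat by rewrite pnatr_eq0.
move: (\prod_(_ <= _ < _) _) (n`!%:R : rat) (k`!%:R : rat) => Q c f.
by move: (k.+1%:R : rat) (n%:R : rat) => x N x0; field.
Qed.

(** Each factor [n + 1 - i] of [n! / (n - k)!] is [- i (1 - (n + 1) / i)]. In the applications
    [n.+1] is [p]. *)
Lemma fact_sub (n k : nat) : (k <= n)%N ->
  n`!%:R = (-1) ^+ k * (n - k)`!%:R * k`!%:R
           * \prod_(1 <= i < k.+1) (1 - n.+1%:R / i%:R) :> rat.
Proof.
elim: k => [|k IHk] le_kn; first by rewrite subn0 big_geq // mul1r !mulr1.
rewrite [in RHS]big_nat_recr //= IHk 1?ltnW // natr_fact_succ (exprS (-1)).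
have -> : (n - k = (n - k.+1).+1)%N by lia.
rewrite natr_fact_succ.
have -> : n.+1%:R = (n - k.+1).+1%:R + k.+1%:R :> rat.
  by rewrite -natrD; congr _%:R; lia.
have : k.+1%:R != 0 :> rat by rewrite pnatr_eq0.
move: (\prod_(_ <= _ < _) _) ((n - k.+1)`!%:R : rat) (k`!%:R : rat) => Q c f.
move: ((-1) ^+ k : rat) => s.
by move: (k.+1%:R : rat) ((n - k.+1).+1%:R : rat) => x N x0; field.
Qed.

Lemma one_add_ratio_neq0 (n i : nat) : 1 + n%:R / i%:R != 0 :> rat.
Proof. by rewrite lt0r_neq0 // ltr_wpDr // divr_ge0. Qed.

Lemma p_integral_one_addV (p i : nat) : prime p -> (1 <= i < p)%N ->
  p_integral p (1 + p%:R / i%:R)^-1.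
Proof.
move=> pr_p hi; have /andP[i0 ip] := hi.
have -> : (1 + p%:R / i%:R)^-1 = i%:R * (p + i)%:R^-1 :> rat.
  have : i%:R != 0 :> rat by rewrite pnatr_eq0 -lt0n.
  have : (p + i)%:R != 0 :> rat by rewrite pnatr_eq0; lia.
  have := one_add_ratio_neq0 p i; rewrite natrD.
  by move: (i%:R : rat) (p%:R : rat) => x P h1 h2 h3; field; rewrite h3 h2.
apply: p_integralM; rewrite ?p_integral_nat ?p_integral_natV //.
by rewrite dvdn_addr // not_dvd_lt.
Qed.

Lemma p_integral_inv_psum (p r n : nat) : prime p -> (n < p)%N ->
  p_integral p (inv_psum r n).
Proof.
move=> pr_p np; apply: (pO_integral p 0) => //; apply: pO_sum => // i hi.
by apply/pO0/p_integralX => //; apply: p_integral_natV => //; apply: not_dvd_lt; lia.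
Qed.

(** The coefficients are the elementary symmetric functions of the [i^-2], the second one in
    Newton's form. *)
Lemma prod_one_sub_sq (p k : nat) : prime p -> odd p -> (k < p)%N ->
  pO p 6 (\prod_(1 <= i < k.+1) (1 - (p%:R / i%:R) ^+ 2)
    - (1 - p%:R ^+ 2 * inv_psum 2 k
       + p%:R ^+ 4 * ((inv_psum 2 k ^+ 2 - inv_psum 4 k) / 2))).
Proof.
move=> pr_p odd_p.
have hV2 : p_integral p 2^-1.
  by apply: (p_integral_natV p 2); rewrite // gtnNdvd // odd_prime_gt2.
elim: k => [|k IHk] kp.
  rewrite big_geq // !inv_psum_zero (_ : _ - _ = 0); last by ring.
  exact: pO_zero.
have {}IHk := IHk (ltnW kp).
rewrite big_nat_recr //= !inv_psum_succ.
have hy : p_integral p k.+1%:R^-1 by apply: p_integral_natV => //; apply: not_dvd_lt.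
have hs := p_integral_inv_psum p 2 k pr_p (ltnW kp).
have hq := p_integral_inv_psum p 4 k pr_p (ltnW kp).
move: IHk hs hq.
move: (\prod_(_ <= _ < _) _) (inv_psum 2 k) (inv_psum 4 k) => Q s q.
move: (k.+1%:R^-1 : rat) hy => y hy h hs hq.
rewrite (_ : _ - _ = (Q - (1 - p%:R ^+ 2 * s + p%:R ^+ 4 * ((s ^+ 2 - q) / 2)))
    * (1 - (p%:R * y) ^+ 2) - p%:R ^+ 6 * (y ^+ 2 * (s ^+ 2 - q) / 2)); last by field.
apply: pOD => //; first by apply: pOMr => //; pint.
by apply/pON/pOMr => //; [apply: pO_pow | pint].
Qed.

(* [4 n^2 wz_t n m] is the ratio [wz_term n.-1 m / wz_term n.-1 0], see
   [wz_term_t]; [wz_u] and [wz_v] collect its factors in [x = n / i] because the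
   linear term of [wz_u] at [0] cancels. *)
Definition wz_u (x : rat) : rat := (1 + 2 * x) ^+ 2 * (1 - x) / (1 + x) ^+ 3.
Definition wz_v (x : rat) : rat := (1 - x) / (1 + x) ^+ 3.

Definition wz_t (n m : nat) : rat :=
  (\prod_(1 <= i < m) wz_u (n%:R / i%:R)) * wz_v (n%:R / m%:R) * m%:R^-1 ^+ 2.

Lemma wz_term_ratio (n m : nat) : (m < n)%N ->
  wz_term n m.+1 = wz_term n m
    * ((2 * n.+1%:R + m%:R) ^+ 2 * (m.+1%:R - n.+1%:R) / (n.+1%:R + m.+1%:R) ^+ 3).
Proof.
move=> lt_mn; rewrite /wz_term.
have -> : (n - m = (n - m.+1).+1)%N by lia.
rewrite !addnS !natr_fact_succ (exprS (-1)).
have -> : m.+1%:R - n.+1%:R = - (n - m.+1).+1%:R :> rat.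
  by rewrite -opprB -natrB; [congr (- _%:R); lia | lia].
have -> : 2 * n.+1%:R + m%:R = (n.*2 + m).+2%:R :> rat.
  by rewrite -natrM -natrD; congr _%:R; lia.
have -> : n.+1%:R + m.+1%:R = (n + m).+2%:R :> rat.
  by rewrite -natrD; congr _%:R; lia.
have : (n - m.+1).+1%:R != 0 :> rat by rewrite pnatr_eq0.
have : (n + m).+2%:R != 0 :> rat by rewrite pnatr_eq0.
have : (n + m).+1%:R != 0 :> rat by rewrite pnatr_eq0.
have := fact_neq0 (n + m); have := fact_neq0 n; have := fact_neq0 (n - m.+1).
move: ((n - m.+1)`!%:R : rat) (n`!%:R : rat) ((n + m)`!%:R : rat) => a b c.
move: ((n + m).+1%:R : rat) ((n + m).+2%:R : rat) ((n - m.+1).+1%:R : rat) => d e f.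
move: ((n.*2 + m).+2%:R : rat) ((n.*2 + m).+1%:R * (n.*2 + m)`!%:R : rat) => x y.
move: (n.*2.+1%:R * (n.*2)`!%:R : rat) ((-1) ^+ _ : rat) => z s a0 b0 c0 d0 e0 f0.
by field; rewrite a0 b0 c0 d0 e0 f0.
Qed.

(** In the product of the successive ratios, the square [(2 n.+1 + j)^2] has index [j] while the
    other factors have index [j + 1]. Regrouping by equal index leaves [4 n.+1^2] from [j = 0], a
    [wz_u] for each inner index, and [wz_v] with an inverse square for the last. *)
Lemma wz_term_t (n m : nat) : (m < n)%N ->
  wz_term n m.+1 = wz_term n 0 * (4 * n.+1%:R ^+ 2 * wz_t n.+1 m.+1).
Proof.
elim: m => [|m IHm] lt_mn.
  rewrite wz_term_ratio // /wz_t big_geq // /wz_v.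
  have := one_add_ratio_neq0 n.+1 1.
  rewrite divr1 invr1 addr0; move: (wz_term n 0) (n.+1%:R : rat) => A x x0.
  by field; rewrite x0.
rewrite (wz_term_ratio _ _ lt_mn).
rewrite (IHm (ltnW lt_mn)).
rewrite /wz_t.
rewrite (big_nat_recr m.+1) //=.
rewrite /wz_u /wz_v.
have := one_add_ratio_neq0 n.+1 m.+1; have := one_add_ratio_neq0 n.+1 m.+2.
have : n.+1%:R + m.+2%:R != 0 :> rat by rewrite -natrD pnatr_eq0.
have : n.+1%:R + m.+1%:R != 0 :> rat by rewrite -natrD pnatr_eq0.
have : m.+1%:R != 0 :> rat by rewrite pnatr_eq0.
have : m.+2%:R != 0 :> rat by rewrite pnatr_eq0.
move: (wz_term n 0) (\prod_(_ <= _ < _) _) => A Q.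
move: (n.+1%:R : rat) (m.+1%:R : rat) (m.+2%:R : rat) => x y z.
move=> z0 y0 xy xz z1 y1.
by field; rewrite z0 y0 !(addrC _ x) xy xz.
Qed.

(** The product is the binomial coefficient [(2n+1)! / ((n+1)! n!)]. *)
Lemma wz_term0 (n : nat) :
  wz_term n 0 = 32 * (-1) ^+ n * n.+1%:R ^+ 2
    * (\prod_(1 <= i < n.+1) (1 + n.+1%:R / i%:R)) ^+ 5.
Proof.
rewrite /wz_term !addn0 subn0.
have -> : (n.*2.+1 = n.+1 + n)%N by lia.
rewrite fact_add natr_fact_succ.
have : n.+1%:R != 0 :> rat by rewrite pnatr_eq0.
have := fact_neq0 n.
set Q := \prod_(_ <= _ < _) _; clearbody Q.
move: (n`!%:R : rat) (n.+1%:R : rat) ((-1) ^+ n : rat) => c x s c0 x0.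
by field; rewrite c0 x0.
Qed.

Lemma wz_term0_even (n : nat) : ~~ odd n ->
  wz_term n 0 = 32 * n.+1%:R ^+ 2
    * (\prod_(1 <= i < n.+1) (1 - (n.+1%:R / i%:R) ^+ 2)) ^+ 5.
Proof.
move=> even_n; rewrite wz_term0 -signr_odd (negbTE even_n) expr0 mulr1.
congr (_ * _ ^+ 5).
under [RHS]eq_bigr => i _ do rewrite -[1 in X in X - _](expr1n _ 2) subr_sqr.
rewrite big_split /= mulrC -[LHS]mulr1; congr (_ * _).
(* At [k = n], [fact_sub] says that the product of the [1 - n.+1 / i] is [(-1)^n], here 1. *)
have := fact_sub n n (leqnn n).
rewrite -signr_odd (negbTE even_n) subnn fact0 expr0 !mul1r.
by rewrite -{1}[_`!%:R]mulr1 => /(mulfI (fact_neq0 n)).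
Qed.

Lemma prod_wz_u (p m : nat) : prime p -> (m < p)%N ->
  pO p 3 (\prod_(1 <= i < m.+1) wz_u (p%:R / i%:R)
    - (1 - 3 * p%:R ^+ 2 * inv_psum 2 m)).
Proof.
move=> pr_p; elim: m => [|m IHm] lt_mp.
  rewrite big_geq // inv_psum_zero (_ : _ - _ = 0); last by ring.
  exact: pO_zero.
have hi : (1 <= m.+1 < p)%N by [].
have {}IHm := IHm (ltnW lt_mp).
have hy := p_integral_natV p _ pr_p (not_dvd_lt _ _ hi).
have hV := p_integral_one_addV p _ pr_p hi.
have nz := one_add_ratio_neq0 p m.+1.
have hs : p_integral p (inv_psum 2 m).
  by apply: p_integral_inv_psum => //; apply: ltnW.
rewrite big_nat_recr //= inv_psum_succ.
move: IHm hs; set Q := \prod_(_ <= _ < _) _; set s := inv_psum 2 m.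
clearbody Q s => hQ hs; rewrite /wz_u.
move: (m.+1%:R^-1 : rat) hy hV nz => y hy hV nz.
(* With [x = p y]: [(1 + 2x)^2 (1 - x) = (1 - 3x^2) (1 + x)^3 + x^3 (4 + 9x + 3x^2)]. *)
rewrite (_ : _ - _ = (Q - (1 - 3 * p%:R ^+ 2 * s))
      * ((1 + 2 * (p%:R * y)) ^+ 2 * (1 - p%:R * y) * (1 + p%:R * y)^-1 ^+ 3)
    + p%:R ^+ 3 * ((1 - 3 * p%:R ^+ 2 * s)
      * (y ^+ 3 * (4 + 9 * (p%:R * y) + 3 * (p%:R * y) ^+ 2)
         * (1 + p%:R * y)^-1 ^+ 3) + 9 * p%:R * s * y ^+ 2)).
  apply: pOD => //; first by apply: pOMr => //; pint.
  by apply: pOMr => //; [apply: pO_pow | pint].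
by move: (p%:R : rat) nz => P nz; field.
Qed.

Lemma sum_wz_t (p : nat) : prime p -> odd p -> (5 < p)%N ->
  pO p 3 (\sum_(1 <= m < p) wz_t p m - inv_psum 2 p.-1).
Proof.
move=> pr_p odd_p p5.
have p_eq : p.-1.+1 = p by rewrite prednK ?prime_gt0.
(* Termwise expansion: [wz_v x = 1 - 4x + 9x^2 + O(x^3)], times the value of the product given by
   [prod_wz_u]. *)
have h : pO p 3 (\sum_(1 <= m < p) (wz_t p m - m%:R^-1 ^+ 2
    + 4 * (p%:R * m%:R^-1 ^+ 3) - 9 * p%:R * (p%:R * m%:R^-1 ^+ 4)
    + 3 * p%:R ^+ 2 * (inv_psum 2 m.-1 * m%:R^-1 ^+ 2))).
  apply: pO_sum => // m hm.
  have hy := p_integral_natV p _ pr_p (not_dvd_lt _ _ hm).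
  have hV := p_integral_one_addV p _ pr_p hm.
  have nz := one_add_ratio_neq0 p m.
  have lt_m1p : (m.-1 < p)%N by lia.
  have hs := p_integral_inv_psum p 2 _ pr_p lt_m1p.
  have := prod_wz_u p _ pr_p lt_m1p.
  rewrite /wz_t; have -> : m.-1.+1 = m by lia.
  move: hs; set Q := \prod_(_ <= _ < _) _; set s := inv_psum 2 _.
  clearbody Q s => hs hQ; rewrite /wz_v.
  move: (m%:R^-1 : rat) hy hV nz => y hy hV nz.
  (* With [x = p y]: [(1 - 4x + 9x^2) (1 + x)^3 = 1 - x + x^3 (16 + 23x + 9x^2)]. *)
  rewrite [X in pO _ _ X](_ : _ = (Q - (1 - 3 * p%:R ^+ 2 * s))
        * ((1 - p%:R * y) * (1 + p%:R * y)^-1 ^+ 3 * y ^+ 2)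
      + p%:R ^+ 3 * (- (1 - 3 * p%:R ^+ 2 * s)
        * (y ^+ 5 * (16 + 23 * (p%:R * y) + 9 * (p%:R * y) ^+ 2)
           * (1 + p%:R * y)^-1 ^+ 3)
        + 12 * s * y ^+ 3 - 27 * p%:R * s * y ^+ 4)).
    apply: pOD => //; first by apply: pOMr => //; pint.
    by apply: pOMr => //; [apply: pO_pow | pint].
  by move: (p%:R : rat) nz => P nz; field.
move: h; rewrite !big_split /= !sumrN -!mulr_sumr.
have := sum_inv_psum 2 p.-1; rewrite p_eq => ->.
have E r : \sum_(1 <= m < p) m%:R^-1 ^+ r = inv_psum r p.-1 by rewrite /inv_psum p_eq.
rewrite !E.
(* The corrections to [H2] are multiples of [p H3], [p^2 H4] and [p^2 H2], all O(p^3). *)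
have h2 : pO p 1 (inv_psum 2 p.-1).
  apply: (inv_psum_even0 p 1) => //.
  by rewrite (_ : _.-1 = 3)%N // !gtnNdvd //; lia.
have h3 := pOpM _ _ _ pr_p (inv_psum3 p pr_p odd_p p5).
have h4 := pOpM _ _ _ pr_p (pOpM _ _ _ pr_p (inv_psum4 p pr_p odd_p p5)).
have h22 := pOpM _ _ _ pr_p (pOpM _ _ _ pr_p h2).
have hi2 := pO_integral _ _ _ pr_p h2.
have hV2 : p_integral p 2^-1.
  by apply: (p_integral_natV p 2); rewrite // gtnNdvd // odd_prime_gt2.
move: h2 h3 h4 h22 hi2; rewrite -[2.*2]/4%N.
move: (\sum_(_ <= _ < _) _) (inv_psum 2 _) (inv_psum 3 _) (inv_psum 4 _) => T a b c.
move: (p%:R : rat) => P h2 h3 h4 h22 ha h.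
rewrite (_ : T - a = (T - a + 4 * (P * b) - 9 * P * (P * c)
    + 3 * P ^+ 2 * ((a ^+ 2 - c) / 2)) + - ((P * b) * 4) + (P * (P * c)) * 9
   + (P * (P * a)) * (- 3 * a * 2^-1) + (P * (P * c)) * (3 * 2^-1)); last by field.
apply: pOD => //; last by apply: pOMr => //; pint.
apply: pOD => //; last by apply: pOMr => //; pint.
apply: pOD => //; last by apply: pOMr => //; pint.
by apply: pOD => //; apply: pON => //; apply: pOMr => //; pint.
Qed.

(** * The two congruences *)

Lemma congr_p_pO (p n : nat) (a b : rat) : prime p ->
  p_integral p b -> pO p n (a - b) -> congr_p p n a b.
Proof.
move=> pr_p hb hab; split=> //.
by rewrite -(subrK b a) p_integralD // (pO_integral _ _ _ pr_p hab).
Qed.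

Lemma not_dvd_fact (p k : nat) : prime p -> (k < p)%N -> ~~ (p %| k`!)%N.
Proof.
move=> pr_p; elim: k => [|k IHk] kp.
  by rewrite fact0 dvdn1 neq_ltn prime_gt1 ?orbT.
by rewrite factS Euclid_dvdM // negb_or IHk 1?ltnW // not_dvd_lt.
Qed.

Lemma pO_fact (p k : nat) : prime p -> (p <= k)%N -> pO p 1 k`!%:R.
Proof.
move=> pr_p le_pk.
have /dvdnP[q ->] : (p %| k`!)%N by rewrite dvdn_fact // prime_gt0.
by exists q%:R; rewrite ?p_integral_nat // natrM mulrC expn1.
Qed.

Lemma sum_term8_half (h : nat) : prime h.*2.+1 -> (3 < h.*2.+1)%N ->
  pO h.*2.+1 5 (\sum_(0 <= k < h.+1) term8 k - 32 * (h.*2.+1 ^ 2)%:R).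
Proof.
set p := h.*2.+1 => pr_p p3; rewrite sum_term8E big_nat_recr //= -addrA.
have odd_p : odd p by rewrite oddS odd_double.
have lt_hp : (h < p)%N by rewrite /p; lia.
have hfV k : (k < p)%N -> p_integral p k`!%:R^-1.
  by move=> kp; rewrite p_integral_natV ?not_dvd_fact.
apply: pOD => //.
  (* For [m < h] the numerator contains [p!^3 (p + m)!^2], hence five factors [p], while
     [h + m + 1 < p] makes the denominator prime to [p]. *)
  apply: pO_sum => // m /andP[_ lt_mh].
  rewrite /wz_term mulrAC; apply: pOMl => //; last first.
    apply: (pOM p 3 2) => //; [apply: (pO_exp p 1 3)|apply: (pO_exp p 1 2)] => //.
      exact: pO_fact.
    by apply: pO_fact => //; rewrite /p; lia.
  have h1 := hfV h lt_hp.
  have h2 : p_integral p (h - m)`!%:R^-1 by apply: hfV; rewrite /p; lia.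
  have h3 : p_integral p ((h + m).+1)`!%:R^-1 by apply: hfV; rewrite /p; lia.
  by rewrite !invfM; pint.
set C := \prod_(1 <= i < h.+1) (1 - (p%:R / i%:R) ^+ 2) : rat.
(* At [m = h] the denominator contains [p!^3] and cancels that of the numerator; [(p + h)!^2]
   provides [p^2]. *)
have -> : wz_term h h = 32 * p%:R ^+ 2 * C ^+ 2.
  rewrite /wz_term subnn fact0 addnn -/p -addSn -/p.
  rewrite -signr_odd odd_double expr0.
  have hf := fact_sub h.*2 h (_ : h <= h.*2)%N; rewrite -/p in hf.
  rewrite fact_add {3}/p natr_fact_succ -/p hf; last by lia.
  have -> : (h.*2 - h = h)%N by lia.
  have -> : C = (\prod_(1 <= i < h.+1) (1 - p%:R / i%:R))
      * (\prod_(1 <= i < h.+1) (1 + p%:R / i%:R)).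
    rewrite -big_split; apply: eq_bigr => i _ /=; ring.
  (* This makes [Q] below nonzero, as the cancellation of [p!^3] requires. *)
  have : (h.*2)`!%:R != 0 :> rat by exact: fact_neq0.
  have := fact_neq0 h; rewrite hf; last by lia.
  have -> : (h.*2 - h = h)%N by lia.
  have : p%:R != 0 :> rat by rewrite pnatr_eq0.
  set Q := \prod_(_ <= _ < _) _; set R := \prod_(_ <= _ < _) (1 + _).
  clearbody Q R; rewrite -signr_odd.
  move: (p%:R : rat) (h`!%:R : rat) => P f P0 f0.
  rewrite !mulf_eq0 !negb_or => /andP[_ Q0].
  by case: (odd h); rewrite ?expr0 ?expr1; field; rewrite P0 f0 Q0.
have hC : pO p 3 (C - 1).
  have h2 : pO p 3 (p%:R ^+ 2 * inv_psum 2 h).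
    apply: (pOM p 2 1) => //; first exact: pO_pow.
    by apply: (inv_psum_half0 p h 1) => //; rewrite gtnNdvd.
  have hV2 : p_integral p 2^-1.
    by apply: (p_integral_natV p 2); rewrite // gtnNdvd // ltnW.
  have hs2 := p_integral_inv_psum p 2 h pr_p lt_hp.
  have hs4 := p_integral_inv_psum p 4 h pr_p lt_hp.
  have := pOW p 3 6 _ pr_p isT (prod_one_sub_sq p h pr_p odd_p lt_hp); rewrite -/C.
  clearbody C; move: (inv_psum 2 h) (inv_psum 4 h) hs2 hs4 h2 => a c ha hc h2 hC.
  have -> : C - 1 = C - (1 - p%:R ^+ 2 * a + p%:R ^+ 4 * ((a ^+ 2 - c) / 2))
      - p%:R ^+ 2 * a + p%:R ^+ 3 * (p%:R * ((a ^+ 2 - c) / 2)) by ring.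
  apply: pOD => //; last by apply: pOMr; [|exact: pO_pow | pint].
  by apply: pOD => //; apply: pON.
have hCi : p_integral p C.
  rewrite -(subrK 1 C); apply: p_integralD; rewrite ?p_integral1 //.
  exact: pO_integral hC.
rewrite natrX (_ : _ - _ = p%:R ^+ 2 * ((C - 1) * (32 * (C + 1)))); last by ring.
by apply: (pOM p 2 3) => //; [apply: pO_pow | apply: pOMr => //; pint].
Qed.

Lemma sum_term8_full (p : nat) : prime p -> odd p -> (5 < p)%N ->
  pO p 7 (\sum_(0 <= k < p) term8 k
    - (32 * (p ^ 2)%:R + 64 * (p ^ 3)%:R * harmonic p.-1)).
Proof.
move=> pr_p odd_p p5.
have p_eq : p.-1.+1 = p by rewrite prednK ?prime_gt0.
rewrite -[X in \sum_(0 <= _ < X) _]p_eq sum_term8E big_nat_recl //.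
have -> : \sum_(0 <= i < p.-1) wz_term p.-1 i.+1
    = wz_term p.-1 0 * (4 * p%:R ^+ 2 * \sum_(1 <= m < p) wz_t p m).
  rewrite -[X in \sum_(1 <= m < X) _]p_eq big_add1 /= !mulr_sumr.
  by apply: eq_big_nat => m /andP[_ hm]; rewrite wz_term_t ?p_eq.
have even_p1 : ~~ odd p.-1 by rewrite -[odd p.-1]negbK -oddS p_eq odd_p.
rewrite wz_term0_even // p_eq !natrX.
have lt_p1p : (p.-1 < p)%N by rewrite p_eq.
have := prod_one_sub_sq p _ pr_p odd_p lt_p1p; rewrite p_eq.
have hT := sum_wz_t p pr_p odd_p p5.
have hH := harmonic_inv_psum2 p pr_p odd_p p5.
have h2 : pO p 1 (inv_psum 2 p.-1).
  apply: (inv_psum_even0 p 1) => //.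
  by rewrite (_ : _.-1 = 3)%N // !gtnNdvd //; lia.
have h4 := inv_psum4 p pr_p odd_p p5.
have hV2 : p_integral p 2^-1.
  by apply: (p_integral_natV p 2); rewrite // gtnNdvd // odd_prime_gt2.
move: h2 h4 hT hH.
move: (inv_psum 2 _) (inv_psum 4 _) (harmonic _) => a c H.
set T := \sum_(_ <= _ < _) _; set C := \prod_(_ <= _ < _) _; clearbody T C.
move=> h2 h4 hT hH hC.
have ha := pO_integral _ _ _ pr_p h2; have hc := pO_integral _ _ _ pr_p h4.

have hT0 : p_integral p T.
  by rewrite -(subrK a T) p_integralD // (pO_integral _ _ _ pr_p hT).
pose b := p%:R ^+ 2 * a.
have hb : pO p 3 b by apply: (pOM p 2 1) => //; apply: pO_pow.
have hb0 := pO_integral _ _ _ pr_p hb.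
have hbb : pO p 5 (b * b) by apply: (pOW p 5 6) => //; apply: (pOM p 3 3).
(* The [p^4] term of the expansion is O(p^5) because [p] divides [H2] and [H4]. *)
have hd : pO p 5 (C - (1 - b)).
  rewrite (_ : _ - _ = C - (1 - p%:R ^+ 2 * a + p%:R ^+ 4 * ((a ^+ 2 - c) / 2))
      + p%:R ^+ 4 * (a * (a / 2) - c * (1 / 2))); last by rewrite /b; field.
  apply: pOD => //; first exact: pOW hC.
  apply: (pOM p 4 1) => //; first exact: pO_pow.
  by apply: pOD => //; [| apply: pON => //]; apply: pOMr => //; pint.
have hC0 : p_integral p C.
  rewrite -(subrK (1 - b) C); apply: p_integralD => //; last by pint.
  exact: pO_integral hd.
have hC5 : pO p 5 (C ^+ 5 - (1 - 5 * b)).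
  rewrite (_ : _ - _ = (C - (1 - b))
      * (C ^+ 4 + C ^+ 3 * (1 - b) + C ^+ 2 * (1 - b) ^+ 2 + C * (1 - b) ^+ 3
         + (1 - b) ^+ 4)
    + b * b * (10 - 10 * b + 5 * b ^+ 2 - b ^+ 3)); last by ring.
  by apply: pOD => //; apply: pOMr => //; pint.
have he : pO p 5 (p%:R ^+ 2 * (T - a)) by apply: (pOM p 2 3) => //; apply: pO_pow.
have ht := pOpM _ _ _ pr_p hH.
(* Modulo [p^5], [C^5 (1 + 4 p^2 T)] is [(1 - 5b) (1 + 4b) = 1 - b - 20 b^2], that is [1 - b], and
   [- b] is [2 p H]. *)
rewrite (_ : _ - _ = p%:R ^+ 2 * (((C ^+ 5 - (1 - 5 * b)) * (1 + 4 * p%:R ^+ 2 * T)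
    + p%:R ^+ 2 * (T - a) * (4 * (1 - 5 * b)) - b * b * 20
    - p%:R * (2 * H + p%:R * a)) * 32)); last by rewrite /b; ring.
apply: (pOM p 2 5) => //; first exact: pO_pow.
apply: pOMr => //; last by pint.
apply: pOD => //; last exact: pON.
apply: pOD => //; last by apply: pON => //; apply: pOMr => //; pint.
by apply: pOD => //; apply: pOMr => //; pint.
Qed.

Lemma p_integral_harmonic (p n : nat) : prime p -> (n < p)%N ->
  p_integral p (harmonic n).
Proof. by move=> pr_p ltnp; rewrite harmonicE p_integral_inv_psum. Qed.

Theorem theorem8 (p : nat) (hp : prime p) (hodd : odd p) :
  (p != 5%N ->
     congr_p p 7 (\sum_(0 <= k < p) term8 k)
                 (32 * (p ^ 2)%:R + 64 * (p ^ 3)%:R * harmonic p.-1))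
  /\
  ((3 < p)%N ->
     congr_p p 5 (\sum_(0 <= k < (p.-1)./2.+1) term8 k) (32 * (p ^ 2)%:R)).
Proof.
split=> [p_neq5 | p3]; apply: congr_p_pO => //.
- have hH := p_integral_harmonic p p.-1 hp; rewrite prednK ?prime_gt0 // leqnn in hH.
  by have {}hH := hH isT; pint.
- case: (ltnP 5 p) => [p5 | le_p5]; first exact: sum_term8_full.
  have -> : p = 3%N by case: p hp hodd p_neq5 le_p5 => [|[|[|[|[|[|p]]]]]].
  (* For [p = 3] the difference is [9100800 - 2880 = 3^7 * 4160]. *)
  exists 4160%:R; first exact: p_integral_nat.
  by apply/eqP; rewrite /harmonic !unlock; vm_compute.
- by pint.
- have p_eq : p = (p.-1./2).*2.+1 by lia.
  by have := @sum_term8_half p.-1./2; rewrite -p_eq; apply.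
Qed.
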